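(* Let $r\ge 2$ and $c\ge 5$ be integers and let $G_{r,c}$ be a balanced $c$-partite tournament with every partite set of size $r$. If for some integer $q\ge 0$, $$\delta(G_{r,c})\ \ge\ q\big(r+\mu(G_{r,c})\big)\left(\frac{c-1}{c-2}\right)$$ and $i_g(G_{r,c})=r(c-1)\beta$ with $0\le \beta<\frac{c-2q-2}{c}$, then for every $x\in V(G_{r,c})$, $$T_q^+(x)\ \le\ \binom{c-1}{q+1}\left(\frac{r}{2}\right)^{c-1}\frac{(1+\beta)^{c-2-2q}\,(q+1)}{c(1-\beta)-2q-2}.$$
   Context: A $c$-partite tournament is a digraph obtained from a complete $c$-partite graph, with partite sets $V_1,\dots,V_c$, by orienting each edge (in exactly one direction). It is balanced if all partite sets have the same number of vertices; $G_{r,c}$ denotes a balanced $c$-partite tournament with $|V_i|=r$ for every $i\in[c]=\{1,\dots,c\}$. A maximal tournament of $G_{r,c}$ is a subtournament of order $c$, i.e. a tournament induced by a choice of exactly one vertex from each partite set. For a vertex $x$ and an integer $q\ge 0$, $T_q^+(x)$ is the number of maximal tournaments of $G_{r,c}$ that contain $x$ and in which $x$ has out-degree at most $q$. For a vertex $x$ of a digraph, $d^+(x)$ and $d^-(x)$ are its out-degree and in-degree. For an oriented graph $D$, $\delta(D)=\min_{x\in V(D)}\min\{d^+(x),d^-(x)\}$. The global irregularity of $D$ is $$i_g(D)=\max_{x,y\in V(D)}\big\{\max\{d^+(x),d^-(x)\}-\min\{d^+(y),d^-(y)\}\big\}.$$ For a vertex $x$ of a $c$-partite tournament $D$ and $i\in[c]$,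 let $d_i^+(x)=|V_i\cap N^+(x)|$ and $d_i^-(x)=|V_i\cap N^-(x)|$, where $N^+(x)$, $N^-(x)$ are the out- and in-neighbourhoods of $x$. The local partite irregularity of $D$ is $$\mu(D)=\max_{x\in V(D)}\max_{i\in[c]}|d_i^+(x)-d_i^-(x)|.$$ *)

(* Defs.v *)
From mathcomp Require Import all_boot all_order all_algebra.
Set Implicit Arguments.
Unset Strict Implicit.
Unset Printing Implicit Defensive.

(* A digraph is a finite vertex type [V] with its arc relation [e]. *)
Section Digraph.
Variables (V : finType) (e : rel V).

Definition out_nbhd (x : V) : {set V} := [set y | e x y].
Definition in_nbhd (x : V) : {set V} := [set y | e y x].
Definition outdeg (x : V) : nat := #|out_nbhd x|.
Definition indeg (x : V) : nat := #|in_nbhd x|.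

(* All degrees are at most #|V|, so for nonempty [V] the default value #|V|
   does not affect the minimum. *)
Definition min_semidegree : nat :=
  \big[minn/#|V|]_(x : V) minn (outdeg x) (indeg x).

(* The terms with x = y are nonnegative, so truncated subtraction does not
   affect the maximum. *)
Definition global_irregularity : nat :=
  \max_(x : V) \max_(y : V)
    (maxn (outdeg x) (indeg x) - minn (outdeg y) (indeg y)).

End Digraph.

(* The partite sets V_0, ..., V_(c-1) are the fibres of [part : V -> 'I_c]. *)
Section Multipartite.
Variables (V : finType) (c : nat) (part : V -> 'I_c) (e : rel V).

Definition partite_set (i : 'I_c) : {set V} := [set x | part x == i].

Definition multipartite_tournament : Prop :=
  forall x y : V,
    if part x == part y then ~~ e x y else e x y (+) e y x.

Definition balanced (r : nat) : Prop := forall i : 'I_c, #|partite_set i| = r.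

Definition outdeg_in (i : 'I_c) (x : V) : nat :=
  #|partite_set i :&: out_nbhd e x|.
Definition indeg_in (i : 'I_c) (x : V) : nat :=
  #|partite_set i :&: in_nbhd e x|.

Definition local_partite_irregularity : nat :=
  \max_(x : V) \max_(i < c) `|((outdeg_in i x)%:Z - (indeg_in i x)%:Z)%R|%N.

(* A maximal tournament is identified with its vertex set. *)
Definition maximal_tournament (T : {set V}) : bool :=
  [forall i : 'I_c, #|T :&: partite_set i| == 1].

Definition num_max_tournaments (q : nat) (x : V) : nat :=
  #|[set T : {set V} |
      [&& maximal_tournament T, x \in T & #|T :&: out_nbhd e x| <= q]]|.

End Multipartite.

(* Main.v *)
Require Import Defs.
From mathcomp Require Import all_boot all_order all_algebra.
From mathcomp Require Import ring lra zify.
Set Implicit Arguments.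
Unset Strict Implicit.
Unset Printing Implicit Defensive.
Import Order.TTheory GRing.Theory Num.Theory.
Local Open Scope ring_scope.

(** Fix [x] and let [a_i] be the number of out-neighbours of [x] in the [i]-th
    partite set. Then [T_q^+(x)] is the sum of the coefficients of degree at
    most [q] of the product of the factors [(r - a_i) + a_i 'X] over the [c - 1]
    other partite sets. Following Hoeffding, replacing [a_i > m > a_j] by [m]
    and [a_i + a_j - m], where [m] is the mean, does not decrease this sum as
    soon as the product of the remaining factors has coefficients
    [W_(q-1) <= W_q]; the degree hypothesis with [h = (r + mu) / 2], which bounds
    every [a_i] and [r - a_i], ensures this. With all [a_i = m], the sum is a
    binomial lower tail, and it is compared with the next term. Finally, writing
    [m = r (1 - beta') / 2], we have [beta' <= beta], the two factors
    [1 + beta'] and [1 - beta'] have product at most 1, and the resulting bound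
    increases with [beta']. *)

(** * Partial coefficient sums of products of linear factors *)

Section LowerTail.
Variable R : realFieldType.
Implicit Types (p : {poly R}) (r h m a b : R) (s : seq R) (q n : nat).

Definition lower_tail q p : R := \sum_(k < q.+1) p`_k.

Definition splitting_poly r s : {poly R} :=
  \prod_(a <- s) ((r - a)%:P + a *: 'X).

Lemma lower_tailD q p1 p2 :
  lower_tail q (p1 + p2) = lower_tail q p1 + lower_tail q p2.
Proof. by rewrite -big_split; apply: eq_bigr => k _; rewrite coefD. Qed.

Lemma lower_tailZ q a p : lower_tail q (a *: p) = a * lower_tail q p.
Proof. by rewrite [RHS]mulr_sumr; apply: eq_bigr => k _; rewrite coefZ. Qed.

Lemma lower_tail_subX q p : lower_tail q (p - p * 'X) = p`_q.
Proof.
rewrite /lower_tail; elim: q => [|q IHq].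
  by rewrite big_ord1 coefB coefMX subr0.
by rewrite big_ord_recr /= IHq coefB coefMX /= addrC subrK.
Qed.

Lemma splitting_poly_cons r a s :
  splitting_poly r (a :: s)
  = (r - a) *: splitting_poly r s + a *: (splitting_poly r s * 'X).
Proof. by rewrite /splitting_poly big_cons mulrDl mul_polyC -scalerAl ['X * _]mulrC. Qed.

Lemma coef_splitting_poly_cons r a s k :
  (splitting_poly r (a :: s))`_k =
    (r - a) * (splitting_poly r s)`_k
    + a * (if k is k'.+1 then (splitting_poly r s)`_k' else 0).
Proof. by rewrite splitting_poly_cons coefD !coefZ coefMX; case: k. Qed.

(** * Sign and growth of the coefficients *)

Definition split_within r h a := [&& 0 <= a, a <= r, a <= h & r - a <= h].

Lemma coef_splitting_poly_ge0 r h s k :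
  all (split_within r h) s -> 0 <= (splitting_poly r s)`_k.
Proof.
elim: s k => [|a s IHs] k /=.
  by rewrite /splitting_poly big_nil coef1 ler0n.
case/andP => /and4P[a0 ar _ _] sP; rewrite coef_splitting_poly_cons.
apply: addr_ge0; apply: mulr_ge0; rewrite ?subr_ge0 //; first exact: IHs.
by case: k => // k; apply: IHs.
Qed.

(** Taking the ['X] term in one more factor multiplies a product by [a / (r - a)], at least [a / h];
    the [k] factors already taken use up at most [k * h] of the sum, and each choice of [k.+1]
    factors arises [k.+1] times. The induction on [s] avoids the division. *)
Lemma coef_splitting_poly_succ r h s k : all (split_within r h) s ->
  (splitting_poly r s)`_k * (\sum_(a <- s) a - k%:R * h)
    <= k.+1%:R * h * (splitting_poly r s)`_k.+1.
Proof.
elim: s k => [|a s IHs] k.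
  move=> _; rewrite big_nil /splitting_poly big_nil !coef1 mulr0 sub0r.
  by case: k => [|k] /=; rewrite ?mul0r ?oppr0 ?mulr0.
move=> sP; have /= /andP[/and4P[a0 ar ah rah] sP'] := sP.
rewrite big_cons !coef_splitting_poly_cons.
have := IHs k sP'; have := coef_splitting_poly_ge0 k sP'.
set S := \sum_(j <- s) j; set W := splitting_poly r s.
case: k => [|k].
  move: W`_0 W`_1 => w0 w1 w0_ge0 IH0.
  have := ler_wpM2l (_ : 0 <= r - a) IH0; rewrite subr_ge0 => /(_ ar).
  have : 0 <= a * w0 * (h - (r - a)) by rewrite !mulr_ge0 ?subr_ge0.
  lra.
have := IHs k sP'; have := coef_splitting_poly_ge0 k sP'; rewrite -/W -/S.
rewrite -[k.+2%:R]natr1 -[k.+1%:R]natr1.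
move: W`_k W`_k.+1 W`_k.+2 (k%:R : R) => w0 w1 w2 t w0_ge0 IH0 w1_ge0 IH1.
(* The claim is [r - a] times [IH1] plus [a] times [IH0], with slack given by the two products
   below. *)
have := ler_wpM2l (_ : 0 <= r - a) IH1; rewrite subr_ge0 => /(_ ar).
have := ler_wpM2l a0 IH0.
have : 0 <= a * w1 * (h - (r - a)) by rewrite !mulr_ge0 ?subr_ge0.
have : 0 <= a * w0 * (h - a) by rewrite !mulr_ge0 ?subr_ge0.
lra.
Qed.

(* With [a + b] fixed, the product of the two factors changes by a multiple of
   [(1 - 'X) ^+ 2], and summing coefficients cancels one factor [1 - 'X]. *)
Lemma lower_tail_exchange r a b a' b' s q : a + b = a' + b' ->
  lower_tail q (splitting_poly r [:: a', b' & s])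
    - lower_tail q (splitting_poly r [:: a, b & s])
  = (a' * b' - a * b)
    * ((splitting_poly r s)`_q
       - if q is q'.+1 then (splitting_poly r s)`_q' else 0).
Proof.
move=> ab; set W := splitting_poly r s.
have -> : splitting_poly r [:: a', b' & s]
  = splitting_poly r [:: a, b & s]
    + (a' * b' - a * b) *: ((W - W * 'X) - (W - W * 'X) * 'X).
  rewrite !splitting_poly_cons -/W -!mul_polyC.
  have -> : b' = a + b - a' by rewrite ab addrAC subrr add0r.
  rewrite !(rmorphB, rmorphD, rmorphM) /=; ring.
rewrite lower_tailD lower_tailZ lower_tail_subX addrAC subrr add0r.
by rewrite coefB coefMX; case: q.
Qed.

(** For positive [q], the sum hypothesis says that the sum minus [(q - 1) * h] is at least [q * h];
    the growth bound at [q - 1] then makes the coefficient difference in the exchange formula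
    nonnegative. *)
Lemma lower_tail_smooth r h a b a' b' s q : 0 < h ->
  a + b = a' + b' -> a * b <= a' * b' ->
  all (split_within r h) s -> q%:R * h * 2 <= \sum_(y <- s) y + h ->
  lower_tail q (splitting_poly r [:: a, b & s])
    <= lower_tail q (splitting_poly r [:: a', b' & s]).
Proof.
move=> h0 ab leab sP hS; rewrite -subr_ge0 (lower_tail_exchange _ _ _ ab).
apply: mulr_ge0; first by rewrite subr_ge0.
rewrite subr_ge0; case: q hS => [|q] hS; first exact: coef_splitting_poly_ge0 sP.
have := coef_splitting_poly_succ q sP; have := coef_splitting_poly_ge0 q sP.
move: (_`_q) (_`_q.+1) => w0 w1 w0_ge0 hw.
have qh0 : 0 < q.+1%:R * h by rewrite mulr_gt0 ?ltr0Sn.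
rewrite -(ler_pM2l qh0) (le_trans _ hw) // mulrC ler_wpM2l //.
move: hS; rewrite -natr1; lra.
Qed.

(** * Smoothing all entries to their mean *)

Lemma perm_splitting_poly r s1 s2 : perm_eq s1 s2 ->
  splitting_poly r s1 = splitting_poly r s2.
Proof. exact: perm_big. Qed.

Lemma has_gt_mean s m : \sum_(a <- s) a = (size s)%:R * m ->
  has (fun a => a != m) s -> has (fun a => m < a) s.
Proof.
move=> sumE; apply: contraLR; rewrite -!all_predC => /allP /= le_m.
have H : \sum_(a <- s) (m - a) = 0.
  by rewrite sumrB sumE big_const_seq count_predT iter_addr addr0 mulr_natl subrr.
move/eqP: H; rewrite big_seq psumr_eq0 => [/allP H|a /le_m]; last first.
  by rewrite -leNgt subr_ge0.
by apply/allP => a sa; have := H a sa; rewrite sa subr_eq0 eq_sym /= negbK.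
Qed.

Lemma has_lt_mean s m : \sum_(a <- s) a = (size s)%:R * m ->
  has (fun a => a != m) s -> has (fun a => a < m) s.
Proof.
move=> sumE ne_m; have := @has_gt_mean (map -%R s) (- m).
rewrite big_map sumrN sumE size_map mulrN !has_map => /(_ erefl) has_gt.
have /has_gt/hasP[b sb] : has (preim -%R (fun a => a != - m)) s.
  by have /hasP[a sa ?] := ne_m; apply/hasP; exists a; rewrite //= eqr_opp.
by rewrite /= ltrN2 => ?; apply/hasP; exists b.
Qed.

(** Induction on the number of entries different from [m]: each exchange turns an entry above and
    one below the mean into [m] and [a + b - m]. *)
Lemma lower_tail_le_mean r h s m q : 0 < h ->
  all (split_within r h) s -> \sum_(a <- s) a = (size s)%:R * m ->
  q%:R * h * 2 + m <= \sum_(a <- s) a ->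
  lower_tail q (splitting_poly r s)
    <= lower_tail q (splitting_poly r (nseq (size s) m)).
Proof.
move=> h0; have [k] := ubnP (count (fun a => a != m) s).
elim: k s => // k IHk s; rewrite ltnS => ltk sP sumE hq.
have [ne_m|] := boolP (has (fun a => a != m) s); last first.
  rewrite -all_predC => /allP /= eq_m.
  suff <- : s = nseq (size s) m by [].
  by apply/all_pred1P/allP => a /eq_m; rewrite negbK.
have /hasP[a sa lt_ma] := has_gt_mean sumE ne_m.
have /hasP[b sb lt_bm] := has_lt_mean sumE ne_m.
have pa := perm_to_rem sa.
have sb' : b \in rem a s.
  have : b \in a :: rem a s by rewrite -(perm_mem pa).
  by rewrite inE => /orP[/eqP E|//]; move: lt_bm; rewrite E ltNge (ltW lt_ma).
have pb := perm_to_rem sb'; set w := rem b (rem a s) in pb.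
have ps : perm_eq s [:: a, b & w].
  by apply: perm_trans pa _; rewrite perm_cons.
have sizeE := perm_size ps.
have sumE' : \sum_(y <- s) y = \sum_(y <- [:: a, b & w]) y by exact: perm_big.
move: sumE hq ltk sP; rewrite sumE' sizeE (perm_splitting_poly r ps).
rewrite (permP ps) (perm_all _ ps) => sumE hq ltk sP.
have /= /and3P[/and4P[a0 ar ah rah] /and4P[b0 br bh rbh] wP] := sP.
have sumE2 : \sum_(y <- [:: m, a + b - m & w]) y = \sum_(y <- [:: a, b & w]) y.
  rewrite !big_cons; ring.
apply: (le_trans (y := lower_tail q (splitting_poly r [:: m, a + b - m & w]))).
  apply: lower_tail_smooth h0 _ _ wP _.
  - by rewrite [RHS]addrC subrK.
  - have : 0 <= (a - m) * (m - b) by rewrite mulr_ge0 // subr_ge0 ltW.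
    lra.
  (* Removing [a] and [b] is affordable because [b < m] gives [a + b - m < a <= h]; this is what the
     term [m] in [hq] pays for. *)
  - move: hq; rewrite !big_cons; lra.
apply: IHk.
- apply: leq_trans ltk; rewrite /= eqxx (gt_eqF lt_ma) (lt_eqF lt_bm) /=.
  by rewrite add0n add1n ltnS leq_add2r leq_b1.
(* Both new entries lie between [b] and [a]. *)
- by rewrite /= wP andbT /split_within; lra.
- by rewrite sumE2 sumE.
- by rewrite sumE2.
Qed.

(** * The binomial lower tail *)

Lemma coef_splitting_poly_nseq r m n k :
  (splitting_poly r (nseq n m))`_k = (r - m) ^+ (n - k) * m ^+ k *+ 'C(n, k).
Proof.
rewrite /splitting_poly big_nseq iter_mulr_1 exprDn.
under eq_bigr => i _ do rewrite -polyC_exp exprZn mul_polyC scalerA -scaler_nat scalerA.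
rewrite coef_sum; under eq_bigr => i _ do rewrite coefZ coefXn.
have [lekn|ltnk] := leqP k n.
  rewrite (bigD1 (Ordinal (lekn : (k < n.+1)%N))) //= eqxx mulr1 big1 ?addr0.
    by rewrite mulr_natl.
  by move=> i ne; rewrite (_ : (k == i) = false) ?mulr0 // eq_sym; apply: negbTE; exact: ne.
rewrite bin_small // mulr0n big1 // => i _.
by rewrite (_ : (k == i) = false) ?mulr0 //; have := ltn_ord i; lia.
Qed.

(** A geometric series bound cleared of denominators: up to index [q], the ratio of a term to the
    next is at most [rho = (q+1)(r-m) / ((n-q)m)], and [rho / (1 - rho) = (q+1)(r-m) / ((n+1)m -
    (q+1)r)]. *)
Lemma lower_tail_binomial r m n q : 0 <= m -> m <= r -> 0 < r ->
  0 <= n.+1%:R * m - q.+1%:R * r ->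
  lower_tail q (splitting_poly r (nseq n m)) * (n.+1%:R * m - q.+1%:R * r)
    <= q.+1%:R * 'C(n, q.+1)%:R * (r - m) ^+ (n - q) * m ^+ q.+1.
Proof.
move=> m0 mr r0.
have binE k : (k.+1%:R * 'C(n, k.+1)%:R = (n%:R - k%:R) * 'C(n, k)%:R :> R).
  have [lekn|ltnk] := leqP k n; last by rewrite !bin_small ?mulr0 // ltnW.
  by rewrite -natrB // -!natrM mul_bin_left.
elim: q => [|q IHq].
  rewrite /lower_tail big_ord1 coef_splitting_poly_nseq binE bin0 subn0 expr0 expr1.
  rewrite mulr1n subr0 !mulr1 -natr1 mul1r => _.
  have : 0 <= (r - m) ^+ n * (r - m) by rewrite mulr_ge0 ?exprn_ge0 ?subr_ge0.
  lra.
move=> Yq2; have {IHq} := IHq _.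
have q0 : 0 <= q%:R :> R by rewrite ler0n.
have Yq1 : 0 < n.+1%:R * m - q.+1%:R * r.
  by apply: lt_le_trans (_ : r <= _) => //; move: Yq2; rewrite -[q.+2%:R]natr1; lra.
move=> /(_ (ltW Yq1)).
(* Since [m <= r], the sign hypothesis forces this, so the truncated exponent [n - q] is
   positive. *)
have ltqn : (q.+1 <= n)%N.
  rewrite -(ler_nat R); rewrite -(ler_pM2r r0).
  have : n%:R * m <= n%:R * r by rewrite ler_wpM2l ?ler0n.
  move: Yq2; rewrite -[q.+2%:R]natr1 -[n.+1%:R]natr1; lra.
have -> : lower_tail q.+1 (splitting_poly r (nseq n m)) =
   lower_tail q (splitting_poly r (nseq n m)) +
     (r - m) ^+ (n - q.+1) * m ^+ q.+1 * 'C(n, q.+1)%:R.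
  by rewrite /lower_tail big_ord_recr /= coef_splitting_poly_nseq mulr_natr.
rewrite (binE q.+1) -[(n - q)%N]prednK ?subn_gt0 // -subnS exprSr [m ^+ q.+2]exprSr.
(* [t] is the coefficient of degree [q.+1]; both right-hand sides are multiples of it. *)
set t := (r - m) ^+ _ * m ^+ q.+1 * _.
have t0 : 0 <= t by rewrite !mulr_ge0 ?exprn_ge0 ?subr_ge0 ?ler0n.
move: (lower_tail _ _) => G.
rewrite (_ : q.+1%:R * _ * _ * _ = q.+1%:R * (r - m) * t); last by rewrite /t; ring.
rewrite (_ : (n%:R - q.+1%:R) * _ * _ * _ = (n%:R - q.+1%:R) * m * t); last by rewrite /t; ring.
move=> hG; rewrite -(ler_pM2r Yq1).
have hG' : (G + t) * (n.+1%:R * m - q.+1%:R * r) <= t * ((n%:R - q%:R) * m).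
  by move: hG; rewrite -[q.+1%:R]natr1 -[n.+1%:R]natr1; lra.
rewrite mulrAC; apply: le_trans (ler_wpM2r Yq2 hG') _.
rewrite -subr_ge0.
have -> : (n%:R - q.+1%:R) * m * t * (n.+1%:R * m - q.+1%:R * r)
   - t * ((n%:R - q%:R) * m) * (n.+1%:R * m - q.+2%:R * r)
   = t * m * (n.+1%:R * (r - m)).
  by rewrite -[q.+2%:R]natr1 -[q.+1%:R]natr1 -[n.+1%:R]natr1; ring.
by clear -t0 m0 mr; clearbody t; rewrite !mulr_ge0 ?ler0n ?subr_ge0.
Qed.

Lemma scaled_binomial_bound r m n q beta : 0 < r -> m <= r ->
  1 - 2 * m / r <= beta -> (2 * q < n)%N ->
  0 < n.+1%:R * (1 - beta) - 2 * q%:R - 2 ->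
  lower_tail q (splitting_poly r (nseq n m))
    <= 'C(n, q.+1)%:R * (r / 2) ^+ n
       * ((1 + beta) ^+ (n - 1 - 2 * q) * (q%:R + 1)
          / (n.+1%:R * (1 - beta) - 2 * q%:R - 2)).
Proof.
(* [beta'] may be negative; [m <= r] yields only [-1 <= beta']. *)
move=> r0 mr hb qn Y0; set beta' := 1 - 2 * m / r in hb.
have mE : m = r / 2 * (1 - beta') by rewrite /beta'; field; rewrite gt_eqF.
have rmE : r - m = r / 2 * (1 + beta') by rewrite {1}mE; field.
have n0 : 0 < n.+1%:R :> R by rewrite ltr0Sn.
have q0 : 0 <= q%:R :> R by rewrite ler0n.
have b'1 : 0 < 1 - beta'.
  have : 0 < n.+1%:R * (1 - beta) by lra.
  by rewrite (pmulr_rgt0 _ n0); lra.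
have b'0 : 0 <= 1 + beta'.
  have : 0 <= r / 2 * (1 + beta') by rewrite -rmE subr_ge0.
  by rewrite pmulr_rge0 // divr_gt0.
have Y'Y : n.+1%:R * (1 - beta) - 2 * q%:R - 2 <= n.+1%:R * (1 - beta') - 2 * q%:R - 2.
  have : n.+1%:R * (1 - beta) <= n.+1%:R * (1 - beta') by rewrite ler_wpM2l ?ler0n //; lra.
  lra.
have Y'0 := lt_le_trans Y0 Y'Y.
have r2 : 0 < r / 2 by rewrite divr_gt0.
have YE : n.+1%:R * m - q.+1%:R * r = r / 2 * (n.+1%:R * (1 - beta') - 2 * q%:R - 2).
  by rewrite {1}mE -natr1; field.
have m0 : 0 <= m by rewrite mE mulr_ge0 // ltW.
have := @lower_tail_binomial r m n q m0 mr r0; rewrite YE.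
have rY0 := mulr_gt0 r2 Y'0; move/(_ (ltW rY0)).
rewrite -ler_pdivlMr // => /le_trans; apply.
rewrite ler_pdivrMr //.
(* Each of the [q.+1] factors [1 - beta'] is paired with a factor [1 + beta']; the remaining
   exponent is a true difference because [2 * q < n]. *)
have -> : q.+1%:R * 'C(n, q.+1)%:R * (r - m) ^+ (n - q) * m ^+ q.+1
  = q.+1%:R * 'C(n, q.+1)%:R * (r / 2) ^+ n.+1
    * (1 + beta') ^+ (n - 1 - 2 * q) * ((1 + beta') * (1 - beta')) ^+ q.+1.
  rewrite rmE mE; move: (r / 2) => h; rewrite !exprMn.
  have -> : (n - q)%N = (n - 1 - 2 * q + q.+1)%N by lia.
  have -> : h ^+ n.+1 = h ^+ (n - 1 - 2 * q + q.+1) * h ^+ q.+1.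
    by rewrite -exprD; congr (_ ^+ _); lia.
  rewrite !exprD; ring.
set K := (n - 1 - 2 * q)%N.
set C := 'C(n, q.+1)%:R.
have C0 : 0 <= q.+1%:R * C * (r / 2) ^+ n.+1.
  by rewrite !mulr_ge0 ?ler0n ?exprn_ge0 // ltW.
rewrite exprSr in C0 *.
(* The paired factors equal [1 - beta' ^+ 2], at most 1, and are dropped; then [beta'] is raised to
   [beta]. *)
apply: (le_trans (y := q.+1%:R * C * ((r / 2) ^+ n * (r / 2)) * (1 + beta) ^+ K)).
  rewrite -mulrA ler_wpM2l //.
  apply: (le_trans (y := (1 + beta') ^+ K)).
    rewrite ler_piMr ?exprn_ge0 // exprn_ile1 //.
      by rewrite mulr_ge0 // ltW.
    have := sqr_ge0 beta'; lra.
  by apply: lerXn2r; rewrite ?nnegrE //; lra.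
have b0 : 0 <= 1 + beta by lra.
set Y := n.+1%:R * (1 - beta) - _ - _ in Y0 Y'Y *.
set Y' := n.+1%:R * (1 - beta') - _ - _ in Y'0 Y'Y *.
have -> : C * (r / 2) ^+ n * ((1 + beta) ^+ K * (q%:R + 1) / Y) * (r / 2 * Y')
  = q.+1%:R * C * ((r / 2) ^+ n * (r / 2)) * (1 + beta) ^+ K * (Y' / Y).
  by rewrite -natr1; ring.
rewrite ler_peMr //; last by rewrite ler_pdivlMr // mul1r.
by apply: mulr_ge0 => //; apply: exprn_ge0.
Qed.

End LowerTail.

(** * Counting the maximal tournaments through a vertex *)

Section Counting.
Variables (V : finType) (c : nat) (part : V -> 'I_c) (e : rel V) (r : nat).
Hypothesis hG : multipartite_tournament part e.
Hypothesis hbal : balanced part r.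

Lemma outdeg_in_part x : outdeg_in part e (part x) x = 0%N.
Proof.
apply/eqP; rewrite cards_eq0 -subset0; apply/subsetP => y; rewrite !inE.
by case/andP => /eqP E exy; have := hG x y; rewrite E eqxx exy.
Qed.

Lemma outdeg_in_add_indeg_in x i : i != part x ->
  (outdeg_in part e i x + indeg_in part e i x)%N = r.
Proof.
move=> ix; rewrite -(hbal i) -(cardsID (out_nbhd e x)); congr addn.
apply: eq_card => y; rewrite !inE andbC; case: eqP => [yi|_]; rewrite ?andbF // !andbT.
have := hG x y; rewrite eq_sym yi (negbTE ix).
by case: (e x y); case: (e y x).
Qed.

Lemma sum_part_card (A : {set V}) : (\sum_(i < c) #|partite_set part i :&: A|)%N = #|A|.
Proof.
rewrite -sum1_card (partition_big part predT) //=; apply: eq_bigr => i _.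
by rewrite -sum1_card; apply: eq_bigl => y; rewrite !inE andbC.
Qed.

Lemma sum_outdeg_in x :
  (\sum_(i < c | i != part x) outdeg_in part e i x)%N = outdeg e x.
Proof.
rewrite /outdeg -sum_part_card [RHS](bigD1 (part x)) //=.
by have := outdeg_in_part x; rewrite /outdeg_in => ->.
Qed.

Lemma outdeg_add_indeg x : (outdeg e x + indeg e x = r * (c - 1))%N.
Proof.
have in0 : #|partite_set part (part x) :&: in_nbhd e x| = 0%N.
  apply/eqP; rewrite cards_eq0 -subset0; apply/subsetP => y; rewrite !inE.
  by case/andP => /eqP E eyx; have := hG y x; rewrite E eqxx eyx.
have -> : indeg e x = (\sum_(i < c | i != part x) indeg_in part e i x)%N.
  by rewrite /indeg -sum_part_card (bigD1 (part x)) //= in0.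
rewrite -sum_outdeg_in -big_split /=.
rewrite (eq_bigr (fun=> r)) => [|i]; last exact: outdeg_in_add_indeg_in.
by rewrite sum_nat_const cardC1 card_ord mulnC subn1.
Qed.

(** Every maximal tournament through [x] is the image of a choice function, whose value on the part
    of [x] is forced to be [x]. *)
Lemma num_max_tournaments_le_choices q x :
  (num_max_tournaments part e q x <=
   #|[set f : {ffun 'I_c -> V} |
       (f \in family (fun i => [pred y | if i == part x then y == x else part y == i]))
       && (#|[set i | e x (f i)]| <= q)]|)%N.
Proof.
set F := [set f | _].
apply: leq_trans (leq_imset_card (fun f : {ffun 'I_c -> V} => [set f i | i : 'I_c]) F).
apply/subset_leq_card/subsetP => T; rewrite inE => /and3P[/forallP Tmax xT Tq].
have Tuniq y z : y \in T -> z \in T -> part y = part z -> y = z.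
  move=> yT zT yz; have /cards1P[w Ew] := Tmax (part y).
  have : y \in T :&: partite_set part (part y) by rewrite !inE yT eqxx.
  have : z \in T :&: partite_set part (part y) by rewrite !inE zT yz eqxx.
  by rewrite Ew !inE => /eqP -> /eqP ->.
(* The default [x] is never taken, as [T] meets every part. *)
pose f := [ffun i => odflt x [pick y in T :&: partite_set part i]].
have fP i : f i \in T /\ part (f i) = i.
  rewrite ffunE; case: pickP => [y|no] /=; first by rewrite !inE => /andP[? /eqP].
  by have /cards1P[w Ew] := Tmax i; have := no w; rewrite Ew inE eqxx.
have fpart y : y \in T -> f (part y) = y.
  by move=> yT; have [fT fy] := fP (part y); exact: Tuniq.
have finj : injective f by move=> i j E; rewrite -(fP i).2 E (fP j).2.
apply/imsetP; exists f; last first.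
  apply/setP => y; apply/idP/imsetP => [yT|[i _ ->]]; last exact: (fP i).1.
  by exists (part y) => //; rewrite fpart.
rewrite inE; apply/andP; split.
  apply/familyP => i; rewrite inE; case: eqP => [->|_]; first by rewrite fpart.
  by rewrite (fP i).2.
apply: leq_trans Tq; rewrite -(card_imset _ finj).
apply/subset_leq_card/subsetP => y /imsetP[i]; rewrite !inE => exi ->.
by rewrite (fP i).1.
Qed.

(** Each factor is the sum of ['X^(e x y)] over the vertices [y] of one part; expanding the product
    enumerates the choice functions by the out-degree of [x]. *)
Lemma splitting_poly_choices (R : realFieldType) x :
  splitting_poly (r%:R : R) [seq (outdeg_in part e i x)%:R | i <- enum 'I_c & i != part x]
  = \sum_(f in family (fun i => [pred y | if i == part x then y == x else part y == i]))
      'X^#|[set i | e x (f i)]|.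
Proof.
rewrite /splitting_poly big_map big_filter big_enum_cond /=.
transitivity (\prod_(i < c)
  \sum_(y | if i == part x then y == x else part y == i) ('X^(e x y) : {poly R})).
  (* The part of [x] contributes the factor 1, since [x] has no loop. *)
  rewrite [RHS](bigD1 (part x)) //= eqxx big_pred1_eq.
  have -> : e x x = false by have := hG x x; rewrite eqxx => /negbTE.
  rewrite expr0 mul1r; apply: eq_bigr => i ix; rewrite (negbTE ix).
  rewrite (bigID (e x)) /=.
  rewrite (eq_bigr (fun=> 'X)); last by move=> y /andP[_ ->].
  rewrite [X in _ = _ + X](eq_bigr (fun=> 1)); last by move=> y /andP[_ /negbTE ->].
  rewrite !sumr_const addrC scaler_nat.
  congr (_ *+ _ + _); first by apply: eq_card => y; rewrite !inE.
  rewrite -(outdeg_in_add_indeg_in ix) natrD addrC addKr polyC_natr; congr _%:R.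
  apply: eq_card => y; rewrite !inE unfold_in; case: eqP => //= yi.
  have := hG x y; rewrite yi eq_sym (negbTE ix).
  by case: (e x y); case: (e y x).
rewrite bigA_distr_big_dep /=; apply: eq_bigr => f _.
rewrite prodrXr -sum1_card [in RHS]big_mkcond; congr 'X^_.
by apply: eq_bigr => i _; rewrite inE; case: (e _ _).
Qed.

Lemma num_max_tournaments_le_lower_tail (R : realFieldType) q x :
  (num_max_tournaments part e q x)%:R <=
  lower_tail q (splitting_poly (r%:R : R)
    [seq (outdeg_in part e i x)%:R | i <- enum 'I_c & i != part x]).
Proof.
rewrite splitting_poly_choices /lower_tail.
under eq_bigr => k _ do rewrite coef_sum.
rewrite exchange_big /=.
apply: (le_trans (y := _%:R)); first by rewrite ler_nat; exact: num_max_tournaments_le_choices.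
rewrite -sum1_card natr_sum big_mkcond [leRHS]big_mkcond /=.
apply: ler_sum => f _; rewrite inE.
case: (f \in _) => //=.
under eq_bigr => k _ do rewrite coefXn.
case: leqP => [le_q|_]; last by apply: sumr_ge0 => k _; rewrite ler0n.
rewrite (bigD1 (Ordinal (le_q : (_ < q.+1)%N))) //= eqxx lerDl.
by apply: sumr_ge0 => k _; rewrite ler0n.
Qed.

(** * Bounds from the irregularities and the semidegree *)

Lemma outdeg_in_le_irregularity x i : i != part x ->
  (2 * outdeg_in part e i x <= r + local_partite_irregularity part e)%N /\
  (2 * indeg_in part e i x <= r + local_partite_irregularity part e)%N.
Proof.
move=> ix; have := outdeg_in_add_indeg_in ix.
have : (`|((outdeg_in part e i x)%:Z - (indeg_in part e i x)%:Z)%R|%N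
   <= local_partite_irregularity part e)%N.
  by apply: (bigop.bigmax_sup x) => //; apply: (bigop.bigmax_sup i).
lia.
Qed.

Lemma min_semidegree_le_outdeg x : (min_semidegree e <= outdeg e x)%N.
Proof.
rewrite /min_semidegree; have := mem_index_enum x.
elim: (index_enum V) => // y w IHw; rewrite big_cons inE => /predU1P[<-|/IHw le_w].
  by apply: leq_trans (geq_minl _ _) (geq_minl _ _).
exact: leq_trans (geq_minr _ _) le_w.
Qed.

Lemma irregularity_ge_sub x : (indeg e x - outdeg e x <= global_irregularity e)%N.
Proof.
apply: (bigop.bigmax_sup x) => //; apply: (bigop.bigmax_sup x) => //; lia.
Qed.

End Counting.

Theorem theorem3 (R : realFieldType) (r c : nat) (hr : (2 <= r)%N)
    (hc : (5 <= c)%N) (V : finType) (part : V -> 'I_c) (e : rel V)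
    (hG : multipartite_tournament part e) (hbal : balanced part r)
    (q : nat) (beta : R)
    (hdelta : q%:R * (r%:R + (local_partite_irregularity part e)%:R)
                * ((c%:R - 1) / (c%:R - 2))
              <= (min_semidegree e)%:R :> R)
    (hirr : (global_irregularity e)%:R = r%:R * (c%:R - 1) * beta)
    (hbeta0 : 0 <= beta)
    (hbeta1 : beta < (c%:R - 2 * q%:R - 2) / c%:R)
    (x : V) :
  (num_max_tournaments part e q x)%:R
  <= 'C(c - 1, q + 1)%:R * (r%:R / 2) ^+ (c - 1)
     * ((1 + beta) ^+ (c - 2 - 2 * q) * (q%:R + 1)
        / (c%:R * (1 - beta) - 2 * q%:R - 2)).
Proof.
apply: le_trans (num_max_tournaments_le_lower_tail hG hbal R q x) _.
(* From here [n] is [c - 1], the number of parts other than that of [x]. *)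
case: c hc part hG hbal hdelta hirr hbeta1 => // n hn part hG hbal.
rewrite !subSS subn0 subn1 addn1 -[n.+1%:R]natr1 => hdelta hirr hbeta1.
set s := [seq _ | i <- _ & _].
have n3 : 3 < n%:R :> R by rewrite (ltr_nat _ 3).
have size_s : size s = n.
  rewrite size_map size_filter -sum1_count big_enum_cond /= sum1_card cardC1.
  by rewrite card_ord.
have sum_s : \sum_(a <- s) a = (outdeg e x)%:R.
  by rewrite big_map big_filter big_enum_cond -natr_sum sum_outdeg_in.
pose m : R := (outdeg e x)%:R / n%:R.
have mE : (outdeg e x)%:R = n%:R * m by rewrite /m mulrC divfK // gt_eqF //; lra.
have r0 : 0 < r%:R :> R by rewrite ltr0n; lia.
have degE : (outdeg e x)%:R + (indeg e x)%:R = r%:R * n%:R :> R.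
  by rewrite -natrD (outdeg_add_indeg hG hbal) natrM subn1.
have mr : m <= r%:R.
  by rewrite /m ler_pdivrMr -?degE ?lerDl ?ler0n //; lra.
pose h : R := (r%:R + (local_partite_irregularity part e)%:R) / 2.
have h0 : 0 < h by rewrite divr_gt0 // ltr_wpDr.
have sP : all (split_within r%:R h) s.
  rewrite all_map; apply/allP => i; rewrite mem_filter => /andP[ix _] /=.
  have [] := outdeg_in_le_irregularity hG hbal ix.
  rewrite -!(ler_nat R) !natrM natrD.
  have : (outdeg_in part e i x)%:R + (indeg_in part e i x)%:R = r%:R :> R.
    by rewrite -natrD (outdeg_in_add_indeg_in hG hbal ix).
  have := ler0n R (indeg_in part e i x); have := ler0n R (outdeg_in part e i x).
  by rewrite /split_within /h => ? ? ? ? ?; apply/and4P; split; lra.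
(* The factor [(c-1)/(c-2)] is [n/(n-1)], so the degree hypothesis gives [q * h * 2 <= (n - 1) * m],
   the sum minus its mean. *)
have hq : q%:R * h * 2 + m <= \sum_(a <- s) a.
  have := min_semidegree_le_outdeg e x; rewrite -(ler_nat R).
  move/(le_trans hdelta); rewrite sum_s mE.
  have -> : q%:R * (r%:R + (local_partite_irregularity part e)%:R) = q%:R * h * 2.
    by rewrite /h; field.
  have -> : n%:R + 1 - 1 = n%:R :> R by ring.
  have -> : n%:R + 1 - 2 = n%:R - 1 :> R by ring.
  rewrite mulrA ler_pdivrMr; last lra.
  move=> hA; rewrite -lerBrDr -(ler_pM2r (_ : 0 < n%:R)); lra.
have := lower_tail_le_mean h0 sP (m := m) (q := q); rewrite size_s {1}sum_s.
move=> /(_ mE hq) /le_trans; apply.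
have Y0 : 0 < (n%:R + 1) * (1 - beta) - 2 * q%:R - 2.
  by move: hbeta1; rewrite ltr_pdivlMr; lra.
have := @scaled_binomial_bound R r%:R m n q beta r0 mr.
rewrite -[n.+1%:R]natr1 (_ : (n - 1 - 2 * q)%N = (n.-1 - 2 * q)%N); last by rewrite subn1.
apply=> //.
(* The global irregularity bounds the in-degree minus the out-degree of [x], which is
   [n * (r - 2 * m)]; dividing by [r * n] gives the bound by [beta]. *)
- have := irregularity_ge_sub e x; rewrite leq_subLR -(ler_nat R) natrD hirr.
  have -> : 1 - 2 * m / r%:R = (r%:R - 2 * m) / r%:R by field; rewrite gt_eqF.
  rewrite ler_pdivrMr // => hi.
  rewrite -(ler_pM2l (_ : 0 < n%:R)); last lra.
  by move: degE hi; rewrite mE; lra.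
(* As [beta] is nonnegative, its strict upper bound forces [2 * q + 2 < c]. *)
- have : 0 <= (n%:R + 1) * beta by rewrite mulr_ge0 //; lra.
  rewrite -(ltr_nat R) natrM => ?.
  have : (2 * q + 2 < n.+1)%N by rewrite -(ltr_nat R) natrD natrM -[n.+1%:R]natr1; lra.
  by rewrite -(natrM R 2) ltr_nat; lia.
Qed.
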